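(* For every non-negative integer $k$ there exists (i) a $6$-regular graph on $39 + 7k$ vertices with exactly $2^{3(k+4)+1} \cdot 3^{k+4} \cdot 5^{4}$ hamiltonian cycles, and (ii) a $7$-regular graph on $54+8k$ vertices with exactly $2^{3(k+7)} \cdot 3^{k+10} \cdot 5^{k+5}$ hamiltonian cycles. *)

(* Defs.v *)
From mathcomp Require Import all_boot.

Set Implicit Arguments.
Unset Strict Implicit.
Unset Printing Implicit Defensive.

Record sgraph := SGraph {
  vertex :> finType;
  adj : rel vertex;
  adj_sym : symmetric adj;
  adj_irrefl : irreflexive adj
}.

Definition regular (d : nat) (G : sgraph) : Prop :=
  forall x : G, #|[set y : G | adj x y]| = d.

(* [c] lists every vertex once, in cyclic order; without [2 < #|G|] a single
   edge traversed back and forth would qualify. *)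
Definition ham_tour (G : sgraph) (c : #|G|.-tuple G) : bool :=
  [&& 2 < #|G|, uniq c & cycle (@adj G) c].

Definition cycle_edges (G : sgraph) (c : seq G) : {set {set G}} :=
  [set [set x; next c x] | x in c].

(* A hamiltonian cycle is a subgraph, identified with its edge set, so the
   choice of starting vertex and of direction of a tour is not counted. *)
Definition ham_cycles (G : sgraph) : {set {set {set G}}} :=
  [set cycle_edges c | c : #|G|.-tuple G & ham_tour c].

(* Main.v *)
Require Import Defs.
From mathcomp Require Import all_boot.

(* Replace an edge ab of a d-regular graph by a copy of K_(d+1) minus an edge uv,
   joined by au and vb.  The new graph is d-regular, and since the copy sits
   behind a 2-edge cut its hamiltonian cycles are those of the old graph through
   ab, with ab replaced by a hamiltonian u-v path of the copy: there are (d-1)!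
   such paths, and (d-2)! of them use a given edge ux.  Start from a d-regular
   graph on n vertices with exactly two hamiltonian cycles through d-2
   prescribed edges (n = 11 for d = 6, n = 14 for d = 7).  Replacing all these
   edges, after k replacements that each prescribe ux in place of ab, gives
   n + (k+d-2)(d+1) vertices and 2 (d-1)!^(d-2) (d-2)!^k hamiltonian cycles. *)

Set Implicit Arguments.
Unset Strict Implicit.
Unset Printing Implicit Defensive.

(** * Duplicate-free enumerations and unordered pairs *)

Lemma uniq_full (T : finType) (c : seq T) :
  uniq c -> size c = #|T| -> forall x, x \in c.
Proof.
move=> /card_uniqP Uc Sc x.
by rewrite (subset_cardP _ (subset_predT (mem c))) // Uc Sc.
Qed.

Lemma full_size (T : finType) (c : seq T) :
  uniq c -> (forall x, x \in c) -> size c = #|T|.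
Proof. by move=> /card_uniqP <- fc; apply: eq_card => x; rewrite fc. Qed.

Lemma set2_eq (T : finType) (x y z t : T) :
  [set x; y] = [set z; t] -> (x = z /\ y = t) \/ (x = t /\ y = z).
Proof.
move=> E.
have: x \in [set z; t] by rewrite -E set21.
have: y \in [set z; t] by rewrite -E set22.
have: z \in [set x; y] by rewrite E set21.
have: t \in [set x; y] by rewrite E set22.
rewrite !inE.
by do 4![case/orP => /eqP ?]; subst; auto.
Qed.

(** * A cyclic sequence and its edge set *)

Section CycleEdges.
Variable G : sgraph.
Implicit Types (c s : seq G) (x y a b : G).

Lemma mem_cycle_edges c x y : uniq c ->
  ([set x; y] \in cycle_edges c) =
  ((x \in c) && (next c x == y)) || ((y \in c) && (next c y == x)).
Proof.
move=> Uc; apply/imsetP/orP => [[z zc /set2_eq[[-> ->]|[-> ->]]]|].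
- by left; rewrite zc eqxx.
- by right; rewrite zc eqxx.
- by case=> /andP[xc /eqP <-]; [exists x | exists y; rewrite // setUC].
Qed.

Lemma cycle_edges_rot n c : uniq c -> cycle_edges (rot n c) = cycle_edges c.
Proof.
move=> Uc; apply/setP => e; apply/imsetP/imsetP => -[x xc ->];
  exists x; rewrite ?next_rot //; by rewrite mem_rot in xc *.
Qed.

Lemma cycle_edges_rev c : uniq c -> cycle_edges (rev c) = cycle_edges c.
Proof.
move=> Uc; apply/setP => e; apply/imsetP/imsetP => -[x xc ->].
  rewrite mem_rev in xc; exists (prev c x); first by rewrite mem_prev.
  by rewrite next_rev // next_prev // setUC.
exists (next c x); first by rewrite mem_rev mem_next.
by rewrite next_rev // prev_next // setUC.
Qed.

Lemma prev_head b s : uniq (b :: s) -> prev (b :: s) b = last b s.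
Proof.
move=> /andP[bs _].
(* As [b] is not in [s], its index in [s] is [size s], which is the position of the last entry of
   [b :: s]. *)
by rewrite prev_nth mem_head (last_nth b) (memNindex bs).
Qed.

(* Every vertex has only two neighbours in a cycle, so fixing the first vertex
   and its predecessor determines the successors one after the other. *)
Lemma cycle_edges_inj b s s' : uniq (b :: s) -> uniq (b :: s') ->
  size s = size s' -> last b s = last b s' -> 1 < size s ->
  cycle_edges (b :: s) = cycle_edges (b :: s') -> s = s'.
Proof.
set c := b :: s; set c' := b :: s' => Uc Uc' Sss El Ss E.
have step x : x \in c -> prev c x = prev c' x -> next c x = next c' x.
  move=> xc Ep; have: [set x; next c x] \in cycle_edges c'.
    by rewrite -E mem_cycle_edges // xc eqxx.
  rewrite mem_cycle_edges // => /orP[/andP[_ /eqP]//|/andP[_ /eqP E1]].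
  (* If [c'] traverses this edge backwards, the two neighbours of [x] in [c] coincide, so [c] has at
     most two entries, against [1 < size s]. *)
  have E2 : prev c x = next c x.
    by rewrite Ep -[x in prev c' x]E1 prev_next.
  have [i t Et] := rot_to xc.
  have Ut : uniq (x :: t) by rewrite -Et rot_uniq.
  have: size (x :: t) = (size s).+1 by rewrite -Et size_rot.
  move: E2; rewrite -(next_rot i Uc) -(prev_rot i Uc) Et prev_head //.
  case: t Ut {Et} => [|y t] Ut; first by move=> _ [S0]; rewrite -S0 in Ss.
  rewrite /next /= eqxx => /= Ey [St].
  case: t Ut Ey St => [|z t] /= Ut Ey St; first by rewrite -St in Ss.
  by case/and3P: Ut => _ /negP[]; rewrite -Ey mem_last.
have iterP i : exists x, [/\ x = iter i (next c) b, x \in c,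
    prev c x = prev c' x & next c x = next c' x].
  elim: i => [|i [x [Ex xc Ep En]]].
    have bc : b \in c by rewrite mem_head.
    have Ep : prev c b = prev c' b by rewrite !prev_head.
    by exists b; split=> //; apply: step.
  have xc' : next c x \in c by rewrite mem_next.
  have Ep' : prev c (next c x) = prev c' (next c x).
    by rewrite prev_next // En prev_next.
  by exists (next c x); split=> //; [rewrite Ex iterS | apply: step].
(* A duplicate-free sequence is the orbit of its head under its own [next], so it suffices to
   compare the iterates of the two successor maps at [b]. *)
have trE t : uniq (b :: t) -> b :: t = traject (next (b :: t)) b (size t).+1.
  move=> Ut; have Eo := orbitE (cycle_next Ut) Ut (mem_head b t).
  rewrite /= eqxx rot0 in Eo.
  by rewrite -[LHS]Eo /orbit; congr traject; rewrite (order_cycle (cycle_next Ut) Ut (mem_head b t)).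
have Ei i : iter i (next c') b = iter i (next c) b.
  by elim: i => // i; rewrite !iterS => ->; case: (iterP i) => x [<- _ _ ->].
have : c = c'.
  rewrite /c /c' (trE s Uc) (trE s' Uc') Sss; apply: (@eq_from_nth _ b).
    by rewrite !size_traject.
  by move=> i; rewrite size_traject => lti; rewrite !nth_traject.
by case.
Qed.
End CycleEdges.

(** * Counting hamiltonian cycles by tours rooted at an edge *)

Section Rooted.
Variable G : sgraph.
Implicit Types (c : #|G|.-tuple G) (a b : G) (F : {set {set G}}).

Lemma ham_tour_rot n c : ham_tour [tuple of rot n c] = ham_tour c.
Proof. by rewrite /ham_tour rot_uniq rot_cycle. Qed.

Lemma ham_tour_rev c : ham_tour [tuple of rev c] = ham_tour c.
Proof.
rewrite /ham_tour rev_uniq rev_cycle; congr [&& _, _ & _].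
by apply: eq_cycle => x y; rewrite adj_sym.
Qed.

(** Normal form of a tour through [ab]: starting at [b] and ending at [a] fixes both the rotation
    and the direction. *)
Definition rooted_tours a b F : {set #|G|.-tuple G} :=
  [set c : #|G|.-tuple G | [&& ham_tour c, head a c == b, last b c == a
                             & F \subset cycle_edges c]].

Lemma rooted_toursP a b F c : c \in rooted_tours a b F ->
  exists s, [/\ c = b :: s :> seq G, last b s = a, uniq (b :: s),
                cycle (@adj G) (b :: s) & 1 < size s].
Proof.
rewrite inE => /and4P[/and3P[n2 Uc Cc] hc lc _].
have Sc := size_tuple c; case: (tval c) Uc Cc hc lc Sc => [|x s] Uc Cc.
  by move=> _ _ Sc; rewrite -Sc in n2.
move=> /eqP /= xb; subst x => /eqP la Sc; exists s; split=> //.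
by rewrite -Sc in n2.
Qed.

(** Each cycle counted passes through [ab], so it has exactly one rooted tour: uniqueness is
    [cycle_edges_inj]; for existence a tour is reversed if it steps from [b] to [a], then
    rotated. *)
Lemma card_ham_rooted a b F :
  (forall C, C \in ham_cycles G -> F \subset C -> [set a; b] \in C) ->
  #|[set C in ham_cycles G | F \subset C]| = #|rooted_tours a b F|.
Proof.
move=> abF; rewrite -(card_in_imset (f := fun c => cycle_edges c)); last first.
  move=> c c' Rc Rc' E; apply: val_inj => /=.
  have [s [Ec ls Us _ Ss]] := rooted_toursP Rc.
  have [s' [Ec' ls' Us' _ _]] := rooted_toursP Rc'.
  rewrite Ec Ec'; congr cons; apply: (@cycle_edges_inj G b) => //.
  - by apply: succn_inj; rewrite -[LHS](congr1 size Ec) -[RHS](congr1 size Ec')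
      !size_tuple.
  - by rewrite ls.
  - by rewrite -Ec -Ec'.
apply: eq_card => C; rewrite inE; apply/andP/imsetP; last first.
  case=> c Rc ->; move: (Rc); rewrite inE => /and4P[tc _ _ Fc]; split=> //.
  by apply: imset_f; rewrite inE.
case=> /imsetP[c]; rewrite inE => tc -> Fc.
have aux d : ham_tour d -> next d a = b ->
    exists2 d', ham_tour d' && (head a d' == b) && (last b d' == a)
              & cycle_edges d' = cycle_edges d.
  move=> td Eab; have /and3P[n2 Ud _] := td.
  have bd : b \in (d : seq G) by rewrite uniq_full ?size_tuple.
  have [i s Es] := rot_to bd.
  exists [tuple of rot i d]; last by rewrite cycle_edges_rot.
  rewrite ham_tour_rot td /= Es /= eqxx /= -prev_head; last first.
    by rewrite -Es rot_uniq.
  by rewrite -Es prev_rot // -Eab prev_next.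
have [d [d1 [d2 d3]]] : exists d, ham_tour d /\ next d a = b /\
    cycle_edges d = cycle_edges c.
  have /and3P[_ Uc _] := tc.
  have := abF (cycle_edges c) _ Fc; rewrite mem_cycle_edges // imset_f ?inE //.
  move=> /(_ isT) /orP[]/andP[_ /eqP E].
    by exists c.
  exists [tuple of rev c]; rewrite ham_tour_rev cycle_edges_rev // next_rev //.
  by rewrite -E prev_next.
have [d' /andP[/andP[t1 t2] t3] Ed] := aux d d1 d2.
exists d'; last by rewrite Ed d3.
by rewrite inE t1 t2 t3 Ed d3.
Qed.

End Rooted.

(** * Edges along a path, and sequences over a disjoint union *)

Section PathEdges.
Variable T : finType.
Implicit Types (x y z : T) (s : seq T).

(** A list rather than a set, so that it splits along concatenations. *)
Definition path_edges x s := pairmap (fun y z => [set y; z]) x s.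

Lemma path_edges_fpath (f : T -> T) x s :
  fpath f x s -> path_edges x s = [seq [set z; f z] | z <- belast x s].
Proof. by elim: s x => //= y s IHs x /andP[/eqP <- /IHs ->]. Qed.

Lemma path_edges_sub x s e z : e \in path_edges x s -> z \in e -> z \in x :: s.
Proof.
elim: s x => //= y s IHs x; rewrite inE => /orP[/eqP-> | /IHs ys /ys].
  by rewrite !inE => /orP[]->; rewrite ?orbT.
by move=> zs; rewrite inE zs orbT.
Qed.

End PathEdges.

Lemma path_edges_map (T T' : finType) (f : T -> T') x s :
  path_edges (f x) (map f s) = [seq f @: (e : {set T}) | e : {set T} <- path_edges x s].
Proof. by elim: s x => //= y s IHs x; rewrite -IHs imsetU1 imset_set1. Qed.

Lemma cycle_edges_path (G : sgraph) (x : G) s : uniq (x :: s) ->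
  cycle_edges (x :: s) =i path_edges x (rcons s x).
Proof.
move=> Us e; rewrite (path_edges_fpath (cycle_next Us)) belast_rcons.
by apply/imsetP/mapP => -[z zs ->]; exists z.
Qed.

(** Cuts at the first left entry. With old vertices on the left and inserted ones on the right, this
    is where a tour leaves the inserted copy. *)
Lemma sum_prefix (A B : Type) (s : seq (A + B)) :
  (exists p, s = map inr p) \/ (exists p x t, s = map inr p ++ inl x :: t).
Proof.
elim: s => [|[x|y] s [[p ->]|[p [z [t ->]]]]]; first by left; exists [::].
- by right; exists [::], x, (map inr p).
- by right; exists [::], x, (map inr p ++ inl z :: t).
- by left; exists (y :: p).
- by right; exists (y :: p), z, t.
Qed.

Lemma sum_inr (A B : eqType) (s : seq (A + B)) :
  (forall x, inl x \notin s) -> exists p, s = map inr p.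
Proof.
case: (sum_prefix s) => [[p ->]|[p [x [t ->]]] /(_ x)]; first by exists p.
by rewrite mem_cat mem_head orbT.
Qed.

(** * Replacing an edge by a clique minus an edge *)

Section Insertion.
Variables (G : sgraph) (a b : G) (m : nat).

Definition ins_vertex : finType := (G + (bool + 'I_m))%type.

Definition port (e : bool) := if e then a else b.

(* The edge [ab] is replaced by a copy of [K_(m+2)] minus an edge; the ends of
   the missing edge are the booleans, [true] being joined to [a] and [false]
   to [b]. *)
Definition ins_adj : rel ins_vertex := fun x y =>
  match x, y with
  | inl x, inl y => adj x y && ([set x; y] != [set a; b])
  | inl x, inr (inl e) | inr (inl e), inl x => x == port e
  | inl _, inr (inr _) | inr (inr _), inl _ => false
  | inr (inl _), inr (inl _) => false
  | inr (inr i), inr (inr j) => i != j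
  | inr _, inr _ => true
  end.

Lemma ins_sym : symmetric ins_adj.
Proof.
move=> [x|[e|i]] [y|[f|j]] //=; last by rewrite eq_sym.
by rewrite adj_sym setUC.
Qed.

Lemma ins_irrefl : irreflexive ins_adj.
Proof. by move=> [x|[e|i]] //=; rewrite ?adj_irrefl ?eqxx. Qed.

Definition ins : sgraph := SGraph ins_sym ins_irrefl.

Definition old (x : G) : ins := inl x.
Definition pole (e : bool) : ins := inr (inl e).
Definition inner (i : 'I_m) : ins := inr (inr i).

Lemma old_inj : injective old. Proof. by move=> x y []. Qed.
Lemma inner_inj : injective inner. Proof. by move=> x y []. Qed.

Lemma card_ins : #|ins| = #|G| + m.+2.
Proof. by rewrite !card_sum card_bool card_ord. Qed.

(** A tour started at [pole e]: the copy is crossed in one block, its inner vertices in the order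
    [p], and the old vertices follow from the opposite port. *)
Definition ins_seq e (p : seq 'I_m) (t : seq G) : seq ins :=
  pole e :: map inner p ++ pole (~~ e) :: map old (port (~~ e) :: t).

(** Inner vertices have no old neighbour, so a path can enter the copy only at a pole. *)
Lemma path_old x t : (forall e, pole e \notin t) -> path (@adj ins) (old x) t ->
  exists2 t', t = map old t'
    & path (fun y z => adj y z && ([set y; z] != [set a; b])) x t'.
Proof.
elim: t x => [|[y|[e|i]] t IHt] x /= nt; first by exists [::].
- case/andP=> Exy /IHt[e|t' -> Pt']; last by exists (y :: t'); rewrite //= Exy.
  by have := nt e; rewrite inE => /norP[].
- by have := nt e; rewrite mem_head.
- by [].
Qed.

(** The copy can be left only at a pole. Leaving at once from [pole e] would reach the final vertex
    [port e] and miss the other pole, so the exit is the other pole. Both poles are then used up: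
    all inner vertices come before the exit and only old vertices after it. *)
Lemma ins_seq_shape e (s : seq ins) : let c := pole e :: s in
  uniq c -> (forall x, x \in c) -> path (@adj ins) (pole e) s ->
  last (pole e) s = old (port e) ->
  exists p t, c = ins_seq e p t /\
    path (fun y z => adj y z && ([set y; z] != [set a; b])) (port (~~ e)) t.
Proof.
move=> c Uc fc; rewrite {}/c in Uc fc *.
case: (sum_prefix s) Uc fc => [[p ->]|[p [x [t ->]]]] Uc fc.
  by rewrite (last_map inr p (inl e)).
rewrite cat_path last_cat (last_map inr p (inl e)) => /andP[_ /= /andP[Ex Pt]] lt.
case: (lastP p) Uc fc Ex Pt lt => [|{}p q] Uc fc.
  move=> /= /eqP Ex; subst x => _ lt; exfalso.
  have St : t = [::].
    case: t Uc {fc} lt => // y t /= /and3P[_ + _] lt.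
    by rewrite -[inl _]lt mem_last.
  by have := fc (pole (~~ e)); rewrite St !inE /= /pole; case: (e).
rewrite last_rcons; case: q Uc fc => // e' Uc fc /= /eqP Ex; subst x.
have Ee : e' = ~~ e.
  move: Uc; rewrite /= map_rcons mem_cat mem_rcons inE !negb_or -!andbA.
  by case/and3P => /eqP; case: (e) (e') => -[].
subst e' => Pt lt.
have Uc' : uniq (pole e :: map inr p ++ pole (~~ e) :: inl (port (~~ e)) :: t).
  by move: Uc; rewrite map_rcons cat_rcons.
have poleP f : pole f = pole e \/ pole f = pole (~~ e).
  by case: (f) (e) => -[]; auto.
have [p' Ep] : exists p', p = map inr p'.
  apply: sum_inr => f; apply/negP => fp.
  have : pole f \in (map inr p : seq ins) by apply: map_f.
  move: Uc'; rewrite cons_uniq cat_uniq mem_cat /= !negb_or.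
  case/andP => /andP[/negP n1 _] /and3P[_ /andP[/negP n2 _] _].
  by case: (poleP f) => ->.
have [t' Et Pt'] : exists2 t', t = map old t'
    & path (fun y z => adj y z && ([set y; z] != [set a; b])) (port (~~ e)) t'.
  apply: path_old Pt => f; apply/negP => ft; move: Uc'.
  rewrite cons_uniq cat_uniq mem_cat /= !inE !negb_or.
  case/andP => /and4P[_ _ _ /negP n1] /and3P[_ _ /andP[/andP[_ /negP n2] _]].
  by case: (poleP f) ft => ->.
exists p', t'; split=> //; rewrite /ins_seq map_rcons cat_rcons Ep Et -map_comp.
by [].
Qed.

(** Only two edges join the copy to the rest, and a hamiltonian cycle uses both. This supplies the
    root edge for [card_ham_rooted]. *)
Lemma ham_ins_edge C : C \in ham_cycles ins -> [set old a; pole true] \in C.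
Proof.
case/imsetP=> c; rewrite inE => /and3P[_ Uc Cc] ->{C}.
have fc : forall x, x \in (c : seq ins) by apply: uniq_full; rewrite ?size_tuple.
have [i s Es] := rot_to (fc (pole true)).
have sa : old a \in s.
  by have := fc (old a); rewrite -(mem_rot i) Es inE.
case: (sum_prefix (rev s)) => [[p Ep]|[p [x [t Et]]]].
  by move: sa; rewrite -mem_rev Ep => /mapP[].
have {}Et : s = rcons (rev t) (inl x) ++ map inr (rev p).
  by rewrite -[s]revK Et rev_cat rev_cons map_rev.
(* Rotation that starts where the cycle enters the copy: an inserted vertex first, the old vertex
   [x] last. *)
set d := (map inr (rev p) ++ pole true :: rcons (rev t) (inl x) : seq ins).
have [j Ed] : exists j, d = rot j (rot i c).
  exists (size (pole true :: rcons (rev t) (inl x))).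
  by rewrite Es Et -cat_cons rot_size_cat.
have Ud : uniq d by rewrite Ed !rot_uniq.
have fd x' : x' \in d by rewrite Ed !mem_rot.
have Cd : cycle (@adj ins) d by rewrite Ed !rot_cycle.
rewrite -(cycle_edges_rot i Uc) -(@cycle_edges_rot _ j) ?rot_uniq // -Ed.
have [k [u Eu]] : exists k u, d = inr k :: u.
  rewrite /d; case: (rev p) => [|k q] /=; first by exists (inl true); eexists.
  by exists k; eexists.
have lu : last (inr k : ins) u = inl x.
  have : last (pole true) d = inl x by rewrite /d last_cat /= last_rcons.
  by rewrite Eu.
rewrite {d Ed}Eu in Ud fd Cd *.
move: Cd; rewrite /cycle rcons_path lu => /andP[Pu].
case: k Pu lu Ud fd => // e Pu lu Ud fd /= /eqP Ex; subst x.
(* The closing edge enters the copy at [pole e]. For [e = true] it is the required edge; for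
   [e = false] the cycle leaves the copy from [pole true] to [old a]. *)
rewrite (@cycle_edges_path ins (pole e)) //; case: e {Et} Pu lu Ud fd => Pu lu Ud fd.
  by rewrite /path_edges -cats1 pairmap_cat lu mem_cat inE eqxx orbT.
have [q [v [[->] _]]] := ins_seq_shape Ud fd Pu lu.
rewrite /path_edges /= rcons_cat pairmap_cat mem_cat /= !inE.
by rewrite [[set old a; _]]setUC eqxx !orbT.
Qed.

Lemma ins_seq_edges p t :
  path_edges (pole true) (rcons (behead (ins_seq true p t)) (pole true)) =
  path_edges (pole true) (rcons (map inner p) (pole false)) ++
  [set pole false; old b] ::
  rcons [seq old @: (e : {set G}) | e : {set G} <- path_edges b t]
        [set old (last b t); pole true].
Proof.
rewrite /= -path_edges_map /path_edges rcons_cat -!cats1 /= !pairmap_cat /=.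
by rewrite pairmap_cat /= last_map -catA.
Qed.

Lemma ins_seq_uniq p t : uniq (ins_seq true p t) = uniq p && uniq (b :: t).
Proof.
rewrite /ins_seq cons_uniq cat_uniq cons_uniq (map_inj_uniq inner_inj).
rewrite (map_inj_uniq old_inj) /= !mem_cat !inE /= !negb_or.
have nI f (q : seq 'I_m) : pole f \in map inner q = false.
  by apply/negP => /mapP[].
have nO x (q : seq G) : inr x \in map old q = false by apply/negP => /mapP[].
have nIO x (q : seq 'I_m) : old x \in map inner q = false.
  by apply/negP => /mapP[].
rewrite !nI !nO !nIO /= (_ : has _ _ = false) //.
by apply/hasPn => _ /mapP[x _ ->]; rewrite nIO.
Qed.

Lemma ins_seq_size p t : size (ins_seq true p t) = (size p + size t).+3.
Proof. by rewrite /= size_cat /= !size_map !addnS. Qed.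

Lemma ins_seq_mem p t : 
  (forall x, x \in ins_seq true p t) -> (forall i, i \in p) /\ (forall x, x \in b :: t).
Proof.
move=> ft; split=> [i|x].
  have := ft (inner i); rewrite /ins_seq !inE mem_cat inE (mem_map inner_inj).
  by case/or3P => // /mapP[].
have := ft (old x); rewrite /ins_seq in_cons mem_cat in_cons.
by rewrite (mem_map old_inj) => /or4P[//|/mapP[]//|//|//].
Qed.

(** The edge [ab] no longer exists; [Some i] prescribes a new edge at [pole true] in its place,
    [None] prescribes none. *)
Definition ins_edges (F : {set {set G}}) (o : option 'I_m) : {set {set ins}} :=
  [set old @: (e : {set G}) | e : {set G} in F :\ [set a; b]]
  :|: (if o is Some i then [set [set pole true; inner i]] else set0).

Lemma mem_cycle_edges_ins p t e : uniq (ins_seq true p t) -> last b t = a ->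
  (e \in cycle_edges (ins_seq true p t)) =
  [|| e \in path_edges (pole true) (rcons (map inner p) (pole false)),
      e == [set pole false; old b],
      e == [set old a; pole true]
    | e \in [seq old @: (e : {set G}) | e : {set G} <- path_edges b t]].
Proof.
move=> Us lt; rewrite (@cycle_edges_path ins (pole true)) //.
by rewrite [path_edges _ _]ins_seq_edges lt mem_cat inE mem_rcons inE.
Qed.

(** Contracting the copy turns the tour into [b :: t]. Its closing edge [ab] stands for the whole
    crossing and is the only one without a counterpart. *)
Lemma mem_cycle_edges_old p t x y :
  uniq (ins_seq true p t) -> last b t = a -> [set x; y] != [set a; b] ->
  (old @: [set x; y] \in cycle_edges (ins_seq true p t)) =
  ([set x; y] \in cycle_edges (b :: t)).
Proof.
move=> Us lt nab; rewrite mem_cycle_edges_ins //.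
have xe : old x \in old @: [set x; y] by rewrite imset_f // set21.
have /negbTE-> : old @: [set x; y]
    \notin path_edges (pole true) (rcons (map inner p) (pole false)).
  apply/negP => /path_edges_sub /(_ xe).
  by rewrite inE mem_rcons inE => /or3P[//|//|/mapP[]].
have nP f z : (old @: [set x; y] == [set pole f; z]) = false.
  apply/eqP => E; have : pole f \in old @: [set x; y] by rewrite E set21.
  by case/imsetP.
rewrite nP [[set old a; _]]setUC nP /= (mem_map (imset_inj old_inj)).
move: Us; rewrite ins_seq_uniq => /andP[_ Ut].
rewrite cycle_edges_path // /path_edges -cats1 pairmap_cat mem_cat lt inE.
by rewrite (negbTE nab) orbF.
Qed.

(** The neighbours of [pole true] in the tour are [old a] and the entry that follows it. *)
Lemma mem_cycle_edges_inner p t i :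
  uniq (ins_seq true p t) -> last b t = a ->
  ([set pole true; inner i] \in cycle_edges (ins_seq true p t)) =
  (ohead p == Some i).
Proof.
move=> Us lt; rewrite mem_cycle_edges_ins //.
have ie : inner i \in [set pole true; inner i] by rewrite set22.
have pe : pole true \in [set pole true; inner i] by rewrite set21.
have -> : ([set pole true; inner i] == [set pole false; old b]) = false.
  by apply/eqP => E; move: ie; rewrite E !inE.
have -> : ([set pole true; inner i] == [set old a; pole true]) = false.
  by apply/eqP => E; move: ie; rewrite E !inE.
have /negbTE-> : [set pole true; inner i] \notin
    [seq old @: (e : {set G}) | e : {set G} <- path_edges b t].
  by apply/negP => /mapP[e _ E]; move: ie; rewrite E => /imsetP[].
rewrite !orbF; case: p {Us} => [|j p] /=; rewrite inE.
  by apply/eqP => E; move: ie; rewrite E !inE.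
have /negbTE-> : [set pole true; inner i] \notin
    path_edges (inner j) (rcons (map inner p) (pole false)).
  apply/negP => /path_edges_sub /(_ pe).
  by rewrite inE mem_rcons inE => /or3P[//|//|/mapP[]].
rewrite orbF; apply/eqP/eqP => [E|[->] //].
by move: ie; rewrite E !inE => /orP[//|/eqP[->]].
Qed.

Definition edge_set (F : {set {set G}}) :=
  forall e, e \in F -> exists x y, adj x y /\ e = [set x; y].

Definition starts_with (o : option 'I_m) (p : seq 'I_m) :=
  if o is Some i then ohead p == Some i else true.

Lemma ins_edges_sub F o p t : edge_set F -> [set a; b] \in F ->
  uniq (ins_seq true p t) -> last b t = a ->
  (ins_edges F o \subset cycle_edges (ins_seq true p t)) =
  starts_with o p && (F \subset cycle_edges (b :: t)).
Proof.
move=> eF abF Us lt; rewrite /ins_edges subUset andbC; congr (_ && _).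
  case: o => [i|]; last by rewrite sub0set.
  by rewrite sub1set mem_cycle_edges_inner.
apply/subsetP/subsetP => sub e.
  move=> eFe; have [x [y [_ Ee]]] := eF _ eFe; subst e.
  (* The edge [ab] imposes no condition on [b :: t]: it closes that tour. *)
  have [->|nab] := eqVneq [set x; y] [set a; b].
    move: Us; rewrite ins_seq_uniq => /andP[_ Ut].
    by rewrite cycle_edges_path // /path_edges -cats1 pairmap_cat mem_cat lt
      inE eqxx orbT.
  rewrite -(@mem_cycle_edges_old p) //; apply: sub.
  by apply: imset_f; rewrite !inE nab.
case/imsetP=> e'; rewrite !inE => /andP[nab eFe] ->.
have [x [y [_ Ee]]] := eF _ eFe; subst e'.
by rewrite mem_cycle_edges_old //; apply: sub.
Qed.

(** These are the hamiltonian paths of the copy between the poles: the inner vertices form a clique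
    joined to both poles, so every order is a path. *)
Definition arrangements o : {set m.-tuple 'I_m} :=
  [set p : m.-tuple 'I_m | uniq p & starts_with o p].

Lemma ins_tuple_subproof (p : m.-tuple 'I_m) (c : #|G|.-tuple G) :
  size (ins_seq true p (behead c)) == #|ins|.
Proof.
have G0 : 0 < #|G| by apply/card_gt0P; exists b.
rewrite ins_seq_size size_behead !size_tuple card_ins.
by case: #|G| G0 => // n _ /=; rewrite !addnS addSn addnC.
Qed.

(** The head of the old tour is dropped because [ins_seq] puts [b = port false] there itself. *)
Definition ins_tuple pc : #|ins|.-tuple ins :=
  Tuple (ins_tuple_subproof pc.1 pc.2).

(** The vertex [b] occurs only at the start, and the first step cannot reach [a], which comes last
    on a path of at least two steps. *)
Lemma path_avoid t : path (@adj G) b t -> uniq (b :: t) -> last b t = a ->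
  1 < size t ->
  path (fun y z => adj y z && ([set y; z] != [set a; b])) b t.
Proof.
case: t => //= x t /andP[bx Pt] /and3P[bt xt Ut] lt; rewrite ltnS => t0.
rewrite bx; apply/andP; split.
  apply/eqP => /set2_eq[[Eb Ex]|[_ Ex]].
    by move: bt; rewrite Ex mem_head.
  by case: t t0 lt xt {Pt bt Ut} => // y t _ /=; rewrite Ex => <-; rewrite mem_last.
apply: (sub_in_path (P := predC1 b) _ _ Pt) => [y z yb zb ->|].
  by apply/eqP => /set2_eq[[_ E]|[E _]]; [move: zb | move: yb]; rewrite inE E eqxx.
by apply/allP => y yt; apply: contraNneq bt => <-.
Qed.

(** With [m = 0] the two poles, which are not adjacent, would be consecutive. *)
Lemma cycle_ins p t : 0 < m -> size p = m -> uniq p -> last b t = a ->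
  path (fun y z => adj y z && ([set y; z] != [set a; b])) b t ->
  cycle (@adj ins) (ins_seq true p t).
Proof.
move=> m0 Sp Up lt Pt; rewrite /= rcons_cat cat_path /= rcons_path last_map lt /=.
rewrite !eqxx !andbT; case: p Sp Up => [S0|i p _ /=]; first by rewrite -S0 in m0.
rewrite (last_map inner p i) /= => /andP[ip Up]; apply/andP; split; last first.
  by rewrite path_map.
rewrite path_map; apply: (@sub_path _ [rel x y | x != y]) => //.
by apply: (@pairwise_sorted _ _ (i :: p)); rewrite -uniq_pairwise /= ip.
Qed.

(** The map [ins_tuple] is a bijection: a rooted tour of [ins] is a free choice of a crossing of the
    copy and of a rooted tour of [G]. *)
Lemma card_rooted_ins F o : edge_set F -> [set a; b] \in F -> adj a b ->
  0 < m -> 2 < #|G| ->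
  #|rooted_tours (old a) (pole true) (ins_edges F o)| =
  #|arrangements o| * #|rooted_tours a b F|.
Proof.
move=> eF abF ab m0 G2.
rewrite -cardsX -(card_in_imset (f := ins_tuple)); last first.
  move=> [p c] [q d]; rewrite !in_setX /= => /andP[_ /rooted_toursP[t [Ec _ _ _ _]]].
  case/andP=> _ /rooted_toursP[u [Ed _ _ _ _]] /(congr1 (fun x => tval x)) /=.
  rewrite Ec Ed /= => -[/eqP]; rewrite eqseq_cat ?size_map ?size_tuple //.
  case/andP => /eqP/(inj_map inner_inj)/val_inj -> /eqP[/(inj_map old_inj) Et].
  by congr pair; apply: val_inj; rewrite /= Ec Ed Et.
apply: eq_card => c'; apply/idP/imsetP => [Rc'|[[p c]]]; last first.
  rewrite in_setX /= inE => /andP[/andP[Up sp] Rc] ->.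
  have [t [Ec lt Ut Ct t1]] := rooted_toursP Rc.
  move: Rc; rewrite !inE /= Ec => /and4P[_ _ _ Fc].
  have Us : uniq (ins_seq true p t) by rewrite ins_seq_uniq Up.
  rewrite ins_edges_sub // sp Fc; apply/and4P; split=> //; last first.
    by rewrite /= last_cat /= last_map lt.
  rewrite /ham_tour /= Ec; apply/and3P; split=> //.
    by rewrite card_ins (leq_trans G2) ?leq_addr.
  apply: cycle_ins; rewrite ?size_tuple //; apply: path_avoid => //.
  by move: Ct; rewrite /= rcons_path => /andP[].
(* Surjectivity: the shape of the tour yields both components. *)
have [s [Ec ls Us Cs _]] := rooted_toursP Rc'.
have fs : forall x, x \in pole true :: s.
  by apply: uniq_full => //; rewrite -Ec size_tuple.
move: Cs; rewrite /= rcons_path => /andP[Ps _].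
have [p [t [Es Pt]]] := ins_seq_shape Us fs Ps ls.
rewrite {}Es in Us fs Ec.
have [fp ft] := ins_seq_mem fs.
have := Us; rewrite ins_seq_uniq => /andP[Up Ut].
have Sp : size p == m by rewrite (full_size Up fp) card_ord.
have St : size (b :: t) == #|G| by rewrite (full_size Ut ft).
have lt : last b t = a.
  move: Rc'; rewrite inE Ec => /and4P[_ _ /eqP + _].
  by rewrite /= last_cat /= last_map => -[].
exists (Tuple Sp, Tuple St); last by apply: val_inj; rewrite /= Ec.
move: Rc'; rewrite !inE Ec ins_edges_sub // => /and4P[_ _ _ /andP[-> Ft]].
rewrite Up /= lt !eqxx Ft !andbT /ham_tour G2 Ut /= rcons_path lt ab andbT.
by apply: sub_path Pt => x y /andP[].
Qed.

Lemma card_ham_ins F o : edge_set F -> [set a; b] \in F -> adj a b ->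
  0 < m -> 2 < #|G| ->
  #|[set C in ham_cycles ins | ins_edges F o \subset C]| =
  #|arrangements o| * #|[set C in ham_cycles G | F \subset C]|.
Proof.
move=> eF abF ab m0 G2.
rewrite (@card_ham_rooted ins (old a) (pole true)) => [|C CH _]; last first.
  exact: ham_ins_edge.
rewrite (@card_ham_rooted G a b) => [|C _ /subsetP]; last exact.
exact: card_rooted_ins.
Qed.

Lemma card_ins_neighbours (x : ins) :
  #|[set y | adj x y]| = #|[set y | adj x (old y)]|
    + (#|[set e | adj x (pole e)]| + #|[set i | adj x (inner i)]|).
Proof.
by rewrite -sum1dep_card /ins /= big_sumType big_sumType !sum1dep_card.
Qed.

(** The vertices [a] and [b] trade each other for a pole; a pole sees its port and [m] inner
    vertices; an inner vertex sees two poles and [m - 1] inner ones. *)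
Lemma ins_regular : adj a b -> regular m.+1 G -> regular m.+1 ins.
Proof.
move=> ab regG x; rewrite card_ins_neighbours.
have nab : a != b by apply: contraTneq ab => ->; rewrite adj_irrefl.
have c0 (T : finType) (P : pred T) : P =1 xpred0 -> #|[set x | P x]| = 0.
  by move=> P0; apply: eq_card0 => z; rewrite inE P0.
have c1 (T : finType) (P : pred T) z : P =1 pred1 z -> #|[set x | P x]| = 1.
  by move=> P1; rewrite -(cards1 z); apply: eq_card => t; rewrite !inE P1.
case: x => [x|[e|i]].
- rewrite [X in _ + (_ + X)]c0 // addn0.
  have [->|xa] := eqVneq x a.
    rewrite (c1 _ _ true) => [|[]] /=; rewrite ?eqxx ?(negbTE nab) //.
    rewrite -(regG a) [in RHS](cardsD1 b) inE ab addn1 add1n; congr _.+1.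
    apply: eq_card => y; rewrite !inE andbC; congr (_ && _); apply/idP/idP.
      by apply: contraNneq => ->.
    by apply: contraNN => /eqP/set2_eq[[_ ->]|[-> ->]].
  have [->|xb] := eqVneq x b.
    rewrite (c1 _ _ false) => [|[]] /=; rewrite ?eqxx 1?eq_sym ?(negbTE nab) //.
    rewrite -(regG b) [in RHS](cardsD1 a) inE adj_sym ab addn1 add1n.
    congr _.+1; apply: eq_card => y; rewrite !inE andbC; congr (_ && _).
    apply/idP/idP.
      by apply: contraNneq => ->; rewrite setUC.
    by apply: contraNN => /eqP/set2_eq[[-> ->]|[_ ->]].
  rewrite [X in _ + X]c0 => [|[]] /=; rewrite ?(negbTE xa) ?(negbTE xb) //.
  rewrite addn0 -(regG x); apply: eq_card => y; rewrite !inE.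
  case: eqP => [/set2_eq[[E _]|[E _]]|]; rewrite ?andbT //.
    by rewrite E eqxx in xa.
  by rewrite E eqxx in xb.
- rewrite (c1 _ _ (port e)) // c0 // -[in RHS](card_ord m) add1n add0n; congr _.+1.
  by apply: eq_card => j; rewrite inE.
rewrite c0 // add0n -[in RHS](card_ord m) [in RHS](cardD1 i) inE -addSn.
congr (_ + _).
  by rewrite -card_bool; apply: eq_card => e; rewrite !inE.
by apply: eq_card => j; rewrite !inE andbT eq_sym.
Qed.

Lemma ins_edge_set (F : {set {set G}}) o : edge_set F -> 
  forall e, e \in ins_edges F o -> exists x y : ins, adj x y /\ e = [set x; y].
Proof.
move=> eF e; rewrite inE => /orP[/imsetP[f]|]; last first.
  case: o => [i|]; rewrite ?inE // => /eqP ->.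
  by exists (pole true), (inner i).
rewrite !inE => /andP[nab fF] ->; have [x [y [xy Ef]]] := eF _ fF; subst f.
exists (old x), (old y); split; first by rewrite /= xy nab.
by rewrite imsetU1 imset_set1.
Qed.

Lemma card_ins_edges (F : {set {set G}}) o : [set a; b] \in F ->
  #|ins_edges F o| = #|F|.-1 + isSome o.
Proof.
move=> abF; rewrite /ins_edges cardsU (card_imset _ (imset_inj old_inj)).
rewrite [in RHS](cardsD1 [set a; b] F) abF /=.
case: o => [i|]; last by rewrite setI0 cards0 !subn0.
rewrite cards1 (_ : _ :&: _ = set0) ?cards0 ?subn0 //.
apply/setP => e; rewrite !inE andbC; case: eqP => //= ->.
apply/imsetP => -[f _ E]; have : pole true \in old @: f by rewrite -E set21.
by case/imsetP.
Qed.
End Insertion.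

(** * Number of crossings of the copy *)

Lemma card_arrangements0 m : #|arrangements (@None 'I_m)| = m`!.
Proof.
rewrite -ffactnn -[X in X ^_ _](card_ord m) -card_uniq_tuples.
by apply: eq_card => p; rewrite !inE andbT all_predT.
Qed.

Lemma card_arrangements1 m (i : 'I_m.+1) : #|arrangements (Some i)| = m`!.
Proof.
have cI : #|predC1 i| = m by rewrite cardC1 card_ord.
rewrite -ffactnn -[X in X ^_ _]cI -card_uniq_tuples.
rewrite -(card_imset _ (f := fun p : m.-tuple 'I_m.+1 => cons_tuple i p)).
  apply: eq_card => p; apply/idP/imsetP => [|[q]].
    case/tupleP: p => j q; rewrite inE /= => /andP[/andP[jq Uq] /eqP[Ej]]; subst j.
    exists q => //; rewrite inE Uq andbT; apply/allP => k kq /=.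
    by apply: contraNneq jq => <-.
  rewrite !inE => /andP[/allP iq Uq] ->; rewrite /= eqxx Uq !andbT.
  by apply/negP => /iq /=; rewrite eqxx.
by move=> p q /(congr1 (fun x => behead (tval x))) /= /val_inj.
Qed.

(** * Iterating the insertion *)

(** The state transformed by insertions. At [r = 0] no edge is prescribed and [N] counts all
    hamiltonian cycles. *)
Definition count_through d n r N := exists (G : sgraph) (F : {set {set G}}),
  [/\ #|G| = n /\ regular d G, edge_set F, #|F| = r
    & #|[set C in ham_cycles G | F \subset C]| = N].

(** Any prescribed edge may be replaced. Degree [d.+2] requires [d.+1] inner vertices, hence [d.+3]
    new vertices. *)
Lemma count_through_ins d n r N o : 2 < n -> count_through d.+2 n r.+1 N ->
  count_through d.+2 (n + d.+3) (r + isSome o) (#|@arrangements d.+1 o| * N).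
Proof.
move=> n2 [G [F [[Gn regG] eF Fr FN]]].
have [e eFe] : exists e, e \in F by apply/card_gt0P; rewrite Fr.
have [a [b [ab Ee]]] := eF _ eFe; subst e.
exists (ins a b d.+1), (ins_edges a b F o); split.
- split; last exact: ins_regular.
  by rewrite card_ins Gn.
- exact: ins_edge_set.
- by rewrite card_ins_edges // Fr.
- by rewrite card_ham_ins ?FN ?Gn.
Qed.

Lemma count_through_close d n r N : 2 < n -> count_through d.+2 n r.+1 N ->
  count_through d.+2 (n + d.+3) r (d.+1`! * N).
Proof.
move=> n2 H; rewrite -[r]addn0 -card_arrangements0.
exact: (count_through_ins None).
Qed.

Lemma count_through_extend d n r N : 2 < n -> count_through d.+2 n r.+1 N ->
  count_through d.+2 (n + d.+3) r.+1 (d`! * N).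
Proof.
move=> n2 H; rewrite -[r.+1]addn1 -(card_arrangements1 ord0).
exact: (count_through_ins (Some ord0)).
Qed.

Lemma count_through_extend_iter d n r N k : 2 < n ->
  count_through d.+2 n r.+1 N ->
  count_through d.+2 (n + k * d.+3) r.+1 (d`! ^ k * N).
Proof.
move=> n2 H; elim: k => [|k IHk]; first by rewrite addn0 mul1n.
rewrite mulSnr addnA expnS -mulnA; apply: count_through_extend => //.
exact: ltn_addr.
Qed.

Lemma count_through_close_iter d n r N k : 2 < n ->
  count_through d.+2 n (k + r) N ->
  count_through d.+2 (n + k * d.+3) r (d.+1`! ^ k * N).
Proof.
elim: k n N => [|k IHk] n N n2 H; first by rewrite addn0 mul1n.
rewrite mulSn addnA expnSr -mulnA; apply: IHk; first exact: ltn_addr.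
exact: count_through_close.
Qed.

Lemma count_through_family d n r k : 2 < n -> count_through d.+2 n r.+1 2 ->
  exists G : sgraph, [/\ #|G| = n + (k + r.+1) * d.+3, regular d.+2 G
    & #|ham_cycles G| = d.+1`! ^ r.+1 * (d`! ^ k * 2)].
Proof.
(* The [k] extensions keep [r.+1] prescribed edges; writing this number as [r.+1 + 0] lets [r.+1]
   closings use them all up. *)
move=> n2 /(count_through_extend_iter k n2); rewrite -[X in count_through _ _ X]addn0.
case/count_through_close_iter; first exact: ltn_addr.
move=> G [F [[Gn regG] _ /eqP]]; rewrite cards_eq0 => /eqP-> <-.
exists G; split=> //; first by rewrite Gn mulnDl addnA.
by apply: eq_card => C; rewrite inE sub0set andbT.
Qed.

(** * Exhaustive search for walks *)

(** An executable search on numbers: [vis] holds the vertices already used, and the start [x] is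
    omitted from the walks returned. *)
Fixpoint walks (e : rel nat) n k x (vis : seq nat) : seq (seq nat) :=
  if k is k'.+1 then
    flatten [seq [seq y :: s | s <- walks e n k' y (y :: vis)]
            | y <- iota 0 n & e x y && (y \notin vis)]
  else [:: [::]].

Lemma mem_walks e n k x vis s : s \in walks e n k x vis =
  [&& size s == k, path e x s, uniq s, ~~ has (mem vis) s & all (ltn^~ n) s].
Proof.
elim: k x vis s => [|k IHk] x vis [|y s] //=; first by apply/flattenP => -[_ /mapP[y _ ->] /mapP[]].
apply/flatten_mapP/idP => [[z]|].
  rewrite mem_filter mem_iota /= add0n => /andP[/andP[xz zv] zn] /mapP[t + [-> ->]].
  rewrite IHk eqSS xz (negbTE zv) zn /= => /and5P[-> -> -> + ->].
  rewrite -all_predC => /allP tv /=; rewrite !andbT -all_predC.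
  apply/andP; split; last by apply/allP => u /tv /=; rewrite inE => /norP[].
  by apply/negP => /tv /=; rewrite mem_head.
rewrite eqSS => /and5P[Ss /andP[xy Ps] /andP[ys Us] /norP[yv sv] /andP[yn sn]].
exists y; first by rewrite mem_filter mem_iota xy yv yn.
apply/mapP; exists s => //; rewrite IHk Ss Ps Us sn andbT -all_predC /=.
apply/allP => u us /=; rewrite inE; apply/norP; split.
  by apply: contraNneq ys => <-.
by move: sv; rewrite -all_predC => /allP /(_ u us).
Qed.

(** * Graphs given by an edge list, and their tours through the spine *)

Section ListedGraph.
Variables (n r : nat) (E : seq (nat * nat)).
Hypotheses (n2 : 1 < n) (r0 : 0 < r) (rn : r <= n).

(** Defined on [nat] so that degrees and tours can be computed; [E] may list an edge in one
    direction only. *)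
Definition list_rel : rel nat :=
  fun x y => (x != y) && (((x, y) \in E) || ((y, x) \in E)).

Definition list_adj : rel 'I_n.+1 := fun x y => list_rel x y.

Lemma list_sym : symmetric list_adj.
Proof. by move=> x y; rewrite /list_adj /list_rel eq_sym orbC. Qed.

Lemma list_irrefl : irreflexive list_adj.
Proof. by move=> x; rewrite /list_adj /list_rel eqxx. Qed.

Definition list_graph := SGraph list_sym list_irrefl.

Lemma list_regular d :
  all (fun x => count (list_rel x) (iota 0 n.+1) == d) (iota 0 n.+1) ->
  regular d list_graph.
Proof.
move=> /allP reg x; rewrite -sum1dep_card /=.
rewrite -(big_mkord (fun y => list_rel x y) (fun=> 1)) sum1_count /index_iota subn0.
by apply/eqP/reg; rewrite mem_iota /= ltn_ord.
Qed.

(* The prescribed edges form the path [0 - 1 - ... - r]; a tour entering [1]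
   from [0] contains it iff it steps from [x] to [x + 1] for every [x < r]. *)
Definition spine : {set {set list_graph}} :=
  [set [set inord i; inord i.+1] | i : 'I_r].

Definition along : rel nat := fun x y => list_rel x y && ((x < r) ==> (y == x.+1)).

(** The walks omit their start [1], and the filter checks the closing step. As [0 < r], vertex [0]
    must be followed by [1], so these tours end at [0]. *)
Definition spine_tours : seq (seq nat) :=
  [seq 1 :: s | s <- walks along n.+1 n 1 [:: 1] & along (last 1 s) 1].

Lemma inordE i : i <= n -> (inord i : 'I_n.+1) = i :> nat.
Proof. exact: inordK. Qed.

Lemma spine_edge i : i < r -> [set inord i; inord i.+1] \in spine.
Proof. by move=> ir; apply/imsetP; exists (Ordinal ir). Qed.

Lemma card_spine : #|spine| = r.
Proof.
rewrite card_imset ?card_ord // => i j /set2_eq.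
have ib (k : 'I_r) : k <= n by rewrite (leq_trans _ rn) // ltnW.
have ib' (k : 'I_r) : k.+1 <= n by rewrite (leq_trans _ rn).
case=> -[/(congr1 (@nat_of_ord _)) + /(congr1 (@nat_of_ord _))].
  by rewrite !inordE // => Eij _; apply: val_inj.
(* The swapped case would give [i = j.+1] and [i.+1 = j]. *)
rewrite !inordE // => -> /eqP.
by rewrite -addn2 -[X in _ == X]addn0 eqn_add2l.
Qed.

(** By induction along the spine: traversing the edge from [i.+1] to [i.+2] backwards would give [i]
    and [i.+2] the same successor. *)
Lemma spine_next (c : seq list_graph) : uniq c -> (forall x, x \in c) ->
  next c (inord 0) = inord 1 ->
  spine \subset cycle_edges c <->
  (forall i, i < r -> next c (inord i) = inord i.+1).
Proof.
move=> Uc fc c0; split=> [/subsetP sub|nxt].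
  elim=> // i IHi ir; have := sub _ (spine_edge ir).
  rewrite mem_cycle_edges // !fc /= => /orP[/eqP //|/eqP Ei].
  have Ei' := IHi (ltnW ir).
  have := congr1 (prev c) Ei; rewrite -Ei' !prev_next // => /(congr1 val).
  have i2 : i.+2 <= n by apply: leq_trans rn.
  rewrite /= (inordE i2) inordE; last by do 2!apply: ltnW.
  move/eqP.
  by rewrite -addn2 -[X in _ == X]addn0 eqn_add2l.
apply/subsetP => _ /imsetP[i _ ->].
by rewrite mem_cycle_edges // fc nxt ?eqxx.
Qed.

Lemma mem_spine_tours (c : #|list_graph|.-tuple list_graph) :
  (c \in @rooted_tours list_graph (inord 0) (inord 1) spine) =
  (map val c \in spine_tours).
Proof.
have Sc : size c = n.+1 by rewrite size_tuple card_ord.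
(* The relation [along] merges adjacency with the forced spine steps, so the search drops a partial
   walk at its first violation. *)
have alongE : uniq c -> cycle (relpre val along) c =
    cycle (@adj list_graph) c && [forall i : 'I_r, next c (inord i) == inord i.+1].
  move=> Uc; have fc := uniq_full Uc (size_tuple c).
  have ib (k : 'I_r) : k <= n by rewrite (leq_trans _ rn) // ltnW.
  have ib' (k : 'I_r) : k.+1 <= n by rewrite (leq_trans _ rn).
  apply/idP/andP => [Cc|[Cc /forallP nxt]].
    split; first by apply: sub_cycle Cc => x y /andP[].
    apply/forallP => i; have := next_cycle Cc (fc (inord i)).
    case/andP=> _ /=; rewrite inordE // ltn_ord => /eqP Ei.
    by apply/eqP/val_inj; rewrite /= Ei inordE.
  apply: cycle_from_next => // x _; apply/andP; split.
    exact: (next_cycle Cc (fc x)).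
  apply/implyP => xr; have := nxt (Ordinal xr); rewrite inord_val => /eqP -> /=.
  by rewrite inordE // (leq_trans xr).
apply/idP/idP.
  move=> Rc; have [s [Ec ls Us Cs Ss]] := rooted_toursP Rc.
  have fc := uniq_full Us; rewrite -Ec in fc; have {}fc := fc (size_tuple c).
  have n01 : next c (inord 0) = inord 1.
    by rewrite -ls -prev_head // Ec next_prev.
  move: (Rc); rewrite inE => /and4P[/and3P[_ Uc Cc] _ _].
  move/(spine_next Uc fc n01) => nxt.
  have : cycle (relpre val along) c.
    by rewrite alongE // Cc; apply/forallP => i; rewrite nxt ?ltn_ord.
  rewrite -cycle_map Ec /= rcons_path inordE; last exact: ltnW.
  case/andP=> Ps al; apply/mapP; exists (map val s) => //.
  have /andP[s1 Us'] := Us.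
  rewrite mem_filter mem_walks; apply/andP; split=> //.
  apply/and5P; split=> //.
  - by apply/eqP; rewrite size_map; move: Sc; rewrite Ec => -[].
  - by rewrite (map_inj_uniq val_inj).
  - rewrite -all_predC; apply/allP => _ /mapP[y ys ->] /=; rewrite inE.
    apply: contraNneq s1 => y1; rewrite (_ : inord 1 = y) //.
    by apply: val_inj; rewrite /= inordE // ltnW.
  - by apply/allP => _ /mapP[y _ ->]; apply: ltn_ord.
case/mapP=> s; rewrite mem_filter mem_walks => /andP[al].
case/and5P=> /eqP Ss Ps Us; rewrite has_sym /= orbF => s1 sn Ec.
have Uc : uniq c.
  by rewrite -(map_inj_uniq val_inj) Ec /= s1.
have fc := uniq_full Uc (size_tuple c).
have : cycle (relpre val along) c by rewrite -cycle_map Ec /= rcons_path Ps.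
rewrite alongE // => /andP[Cc /forallP nxt].
have nxt' i : i < r -> next c (inord i) = inord i.+1.
  by move=> ir; have /eqP := nxt (Ordinal ir).
have n01 := nxt' _ r0.
have Fc : spine \subset cycle_edges c by apply/spine_next.
have [t Et] : exists t, c = inord 1 :: t :> seq list_graph.
  case: (tval c) Ec => // y t [y1 _]; exists t; congr cons.
  by apply: val_inj; rewrite /= y1 inordE // ltnW.
have lt : last (inord 1 : list_graph) t = inord 0.
  by rewrite -(@prev_head list_graph) -Et // -n01 prev_next.
rewrite inE; apply/and4P; split=> //.
  by rewrite /ham_tour Uc Cc card_ord ltnS n2.
  by rewrite Et.
by rewrite Et /= lt.
Qed.

Lemma card_spine_tours : uniq spine_tours ->
  #|@rooted_tours list_graph (inord 0) (inord 1) spine| = size spine_tours.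
Proof.
move=> Ul; pose f (c : #|list_graph|.-tuple list_graph) := map val c.
have fI : injective f by move=> c d /(inj_map val_inj)/val_inj.
rewrite cardE -(size_map f); apply/perm_size/uniq_perm => //.
  by rewrite map_inj_uniq ?enum_uniq.
move=> s; apply/mapP/idP => [[c]|sl].
  by rewrite mem_enum mem_spine_tours => ? ->.
have [Ss sn] : size s = n.+1 /\ all (ltn^~ n.+1) s.
  move: sl => /mapP[t]; rewrite mem_filter mem_walks => /andP[_].
  by case/and5P => /eqP St _ _ _ tn -> /=; rewrite St tn ltnS ltnW.
pose c0 := [seq inord i : list_graph | i <- s].
have Sc : size c0 == #|list_graph| by rewrite size_map Ss card_ord.
have Ec : s = f (Tuple Sc).
  rewrite /f /= -map_comp -[LHS]map_id; apply/eq_in_map => i /(allP sn) lti /=.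
  by rewrite inordK.
by exists (Tuple Sc) => //; rewrite mem_enum mem_spine_tours -/(f _) -Ec.
Qed.

(** For a concrete edge list every hypothesis is a closed boolean test, decided by evaluation. *)
Lemma count_through_list d :
  all (fun x => count (list_rel x) (iota 0 n.+1) == d) (iota 0 n.+1) ->
  all (fun i => list_rel i i.+1) (iota 0 r) -> uniq spine_tours ->
  count_through d n.+1 r (size spine_tours).
Proof.
move=> reg spn Ul; exists list_graph, spine; split.
- by split; [rewrite card_ord | apply: list_regular].
- move=> _ /imsetP[i _ ->]; exists (inord i), (inord i.+1); split=> //=.
  rewrite /list_adj !inordE ?(leq_trans _ rn) // 1?ltnW //.
  by apply: (allP spn); rewrite mem_iota /=.
- exact: card_spine.
rewrite (@card_ham_rooted list_graph (inord 0) (inord 1)) ?card_spine_tours //.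
by move=> C _ /subsetP; apply; apply: spine_edge.
Qed.

End ListedGraph.

(** * The two base graphs and the final count *)

(* [base6] and [base7] were found by simulated annealing on regular graphs,
   minimising the number of hamiltonian cycles through the spine. *)
Definition base6 := [:: 
  (0, 1); (0, 5); (0, 6); (0, 7); (0, 8); (0, 9); (1, 2); (1, 5); (1, 6);
  (1, 7); (1, 10); (2, 3); (2, 5); (2, 6); (2, 8); (2, 10); (3, 4); (3, 5);
  (3, 6); (3, 7); (3, 9); (4, 5); (4, 6); (4, 7); (4, 8); (4, 10); (5, 9);
  (6, 8); (7, 9); (7, 10); (8, 9); (8, 10); (9, 10)].

Definition base7 := [:: 
  (0, 1); (0, 6); (0, 7); (0, 8); (0, 9); (0, 11); (0, 12); (1, 2); (1, 6);
  (1, 7); (1, 8); (1, 9); (1, 10); (2, 3); (2, 6); (2, 7); (2, 8); (2, 12);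
  (2, 13); (3, 4); (3, 6); (3, 7); (3, 8); (3, 10); (3, 12); (4, 5); (4, 6);
  (4, 7); (4, 10); (4, 12); (4, 13); (5, 6); (5, 7); (5, 8); (5, 10);
  (5, 11); (5, 13); (6, 9); (7, 12); (8, 9); (8, 11); (9, 10); (9, 11);
  (9, 13); (10, 11); (10, 13); (11, 12); (11, 13); (12, 13)].

Lemma count_through_base6 : count_through 6 11 4 2.
(* Unification evaluates the length of the list of tours to [2]; [vm_compute] settles the remaining
   tests. *)
Proof. by apply: (@count_through_list 10 4 base6 _ _ _ 6); vm_compute. Qed.

Lemma count_through_base7 : count_through 7 14 5 2.
Proof. by apply: (@count_through_list 13 5 base7 _ _ _ 7); vm_compute. Qed.

Theorem theorem3 (k : nat) :
  (exists G : sgraph,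
     [/\ #|G| = 39 + 7 * k,
         regular 6 G
       & #|ham_cycles G| = 2 ^ (3 * (k + 4) + 1) * 3 ^ (k + 4) * 5 ^ 4])
  /\
  (exists G : sgraph,
     [/\ #|G| = 54 + 8 * k,
         regular 7 G
       & #|ham_cycles G| = 2 ^ (3 * (k + 7)) * 3 ^ (k + 10) * 5 ^ (k + 5)]).
Proof.
split.
  have [G [Gn regG hG]] := count_through_family k (isT : 2 < 11) count_through_base6.
  exists G; split=> //; first by rewrite Gn mulnDl addnCA addnC [k * _]mulnC.
  (* Stated for variables to keep the powers symbolic; it is applied to [5! = 2^3 * 3 * 5] and
     [4! = 2^3 * 3], with [w = 2] for the two base cycles. *)
  have pow x y z w : (x ^ 3 * y * z) ^ 4 * ((x ^ 3 * y) ^ k * w) =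
      x ^ (3 * (k + 4)) * w * y ^ (k + 4) * z ^ 4.
    rewrite mulnDr (expnMn (x ^ 3 * y)) !(expnMn (x ^ 3) y) -!expnM !expnD.
    by rewrite [LHS](AC (3*3) (4*1*6*(5*2)*3)).
  by rewrite hG -[5`!]/(2 ^ 3 * 3 * 5) -[4`!]/(2 ^ 3 * 3) pow [2 ^ (_ + 1)]expnD.
have [G [Gn regG hG]] := count_through_family k (isT : 2 < 14) count_through_base7.
exists G; split=> //; first by rewrite Gn mulnDl addnCA addnC [k * _]mulnC.
(* Applied to [6! = 2^4 * 3^2 * 5] and [5! = 2^3 * 3 * 5]. The factor [2] from the base cycles
   completes the exponent, as [4 * 5 + 1 = 3 * 7]. *)
have pow x y z : (x ^ 4 * y ^ 2 * z) ^ 5 * ((x ^ 3 * y * z) ^ k * x) =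
    x ^ (3 * (k + 7)) * y ^ (k + 10) * z ^ (k + 5).
  rewrite mulnDr (expnMn (x ^ 4 * y ^ 2)) (expnMn (x ^ 4)) (expnMn (x ^ 3 * y)).
  rewrite (expnMn (x ^ 3) y) -!expnM !expnD -[3 * 7]/(4 * 5 + 1) -[10]/(2 * 5).
  rewrite (expnD x (4 * 5)) expn1.
  by rewrite [LHS](AC (3*4) (4*(1*7)*(5*2)*(6*3))).
by rewrite hG -[6`!]/(2 ^ 4 * 3 ^ 2 * 5) -[5`!]/(2 ^ 3 * 3 * 5) pow.
Qed.
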